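(* Let $d\ge 1$ be an integer. For any pair of sequences of positive integers $b=b(n)\to\infty$ and $k=k(n)\to\infty$ (as $n\to\infty$) satisfying $n/(bk\log(b)+k^d\log(k^d))\to\infty$, there exists an estimator (a sequence of estimators) $V_n\in\widetilde{\mathcal{H}}_{d,b}^k$ such that, for all $\varepsilon>0$, $$\sup_{p\in\mathcal{D}_d}P\left(\|V_n-p\|>3\min_{q\in\widetilde{\mathcal{H}}_{d,b}^k}\|p-q\|+\varepsilon\right)\to 0 \quad\text{as } n\to\infty,$$ where $V_n$ is a function of $X_1,\ldots,X_n\overset{iid}{\sim}p$.
   Context: $\mathcal{D}_d$ is the set of all probability densities (with respect to Lebesgue measure) on $[0,1)^d$, and $\|\cdot\|$ is the $L^1$ norm. $[b]=\{1,\ldots,b\}$. $\mathcal{T}_{d,k}$ is the set of probability tensors in $\mathbb{R}^{k\times\cdots\times k}$ ($d$ modes), i.e. tensors with nonnegative entries summing to one. For $i\in[b]$ let $h_{1,b,i}(x)=b\,\mathbf{1}\left(\frac{i-1}{b}\le x<\frac{i}{b}\right)$ on $[0,1)$, and let $\mathcal{H}_{1,b}=\operatorname{Conv}\{h_{1,b,i}: i\in[b]\}$ be the set of one-dimensional histograms with $b$ bins. The product symbol between functions denotes the outer (tensor) product: $\left(\prod_{j=1}^d f_j\right)(x_1,\ldots,x_d)=f_1(x_1)\cdots f_d(x_d)$. The set of Tucker histograms is $$\widetilde{\mathcal{H}}_{d,b}^k=\left\{\sum_{S\in[k]^d}W_S\prod_{i=1}^d f_{i,S_i}\;\middle|\;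 W\in\mathcal{T}_{d,k},\ f_{i,j}\in\mathcal{H}_{1,b}\ (i\in[d],\,j\in[k])\right\}.$$ An estimator $V_n\in\widetilde{\mathcal{H}}_{d,b}^k$ is a (measurable) map, not depending on $p$ or $\varepsilon$, from samples $(X_1,\ldots,X_n)\in([0,1)^d)^n$ to $\widetilde{\mathcal{H}}_{d,b(n)}^{k(n)}$; $P$ is the probability over $X_1,\ldots,X_n$ iid with density $p$. *)

(* Defs.v *)
From HB Require Import structures.
From mathcomp Require Import all_boot all_order all_algebra.
From mathcomp Require Import all_classical all_reals all_analysis.
From mathcomp Require Import measurable_realfun.

Set Implicit Arguments.
Unset Strict Implicit.
Unset Printing Implicit Defensive.
Import Order.TTheory GRing.Theory Num.Theory.
Import numFieldNormedType.Exports.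

Local Open Scope classical_set_scope.
Local Open Scope ring_scope.

Section power_measure.
Local Open Scope ereal_scope.
Context {disp : measure_display} {T : measurableType disp} {R : realType}.
Variable m : {sigma_finite_measure set T -> \bar R}.

Definition cons_pair (n : nat) (x : T * n.-tuple T) : n.+1.-tuple T :=
  [the n.+1.-tuple T of x.1 :: x.2].

Lemma measurable_cons_pair (n : nat) : measurable_fun setT (@cons_pair n).
Proof. exact: measurable_cons. Qed.

Section cons_measure.
Variables (n : nat) (mu : {measure set (n.-tuple T) -> \bar R}).

Definition cons_measure : set (n.+1.-tuple T) -> \bar R :=
  pushforward (m \x^ mu) (@cons_pair n).

Let measurable_preimage (A : set (n.+1.-tuple T)) :
  measurable A -> measurable (@cons_pair n @^-1` A).
Proof.
by move=> mA; rewrite -[X in measurable X]setTI; exact: measurable_cons_pair.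
Qed.

Let cons_measure0 : cons_measure set0 = 0.
Proof. by rewrite /cons_measure /pushforward preimage_set0 measure0. Qed.

Let cons_measure_ge0 A : 0 <= cons_measure A.
Proof. by rewrite /cons_measure /pushforward measure_ge0. Qed.

Let cons_measure_sigma_additive : semi_sigma_additive cons_measure.
Proof.
move=> F mF tF mUF; rewrite /cons_measure /pushforward preimage_bigcup.
apply: measure_semi_sigma_additive.
- by move=> i; exact: measurable_preimage.
- apply/trivIsetP => /= i j _ _ ij; rewrite -preimage_setI.
  by move/trivIsetP : tF => /(_ _ _ _ _ ij) ->//; rewrite preimage_set0.
- by rewrite -preimage_bigcup; exact: measurable_preimage.
Qed.

HB.instance Definition _ := isMeasure.Build _ _ _ cons_measure
  cons_measure0 cons_measure_ge0 cons_measure_sigma_additive.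

End cons_measure.

(* The n-fold product measure; see power_measure_box. *)
Fixpoint power_measure (n : nat) : {measure set (n.-tuple T) -> \bar R} :=
  match n with
  | 0 => dirac [tuple]
  | n'.+1 => cons_measure (power_measure n')
  end.

Lemma measurable_box (n : nat) (A : 'I_n -> set T) :
  (forall i, measurable (A i)) ->
  measurable [set x : n.-tuple T | forall i, A i (tnth x i)].
Proof.
move=> mA.
rewrite (_ : [set _ | _] =
    \big[setI/setT]_(i < n) ((fun x : n.-tuple T => tnth x i) @^-1` A i)).
  apply: bigsetI_measurable => i _.
  have := @measurable_tnth _ T n i measurableT (A i) (mA i).
  by rewrite setTI.
apply/seteqP; split=> [x /= Ax|x].
  by elim/big_ind : _ => // i _; exact: Ax.
by move=> + i /=; rewrite (bigD1 i)//= => -[].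
Qed.

Lemma power_measure_box (n : nat) (A : 'I_n -> set T) :
  (forall i, measurable (A i)) ->
  power_measure n [set x | forall i, A i (tnth x i)] =
  \prod_(i < n) m (A i).
Proof.
elim: n A => [|n IHn] A mA.
  by rewrite big_ord0 /= diracE mem_set//= => -[].
rewrite big_ord_recl /= /cons_measure /pushforward.
rewrite (_ : _ @^-1` _ = A ord0 `*`
    [set x : n.-tuple T | forall i, A (lift ord0 i) (tnth x i)]).
  rewrite product_measure2E//; last first.
    by apply: (@measurable_box n (fun i => A (lift ord0 i))) => i; exact: mA.
  by rewrite (IHn (fun i => A (lift ord0 i)))// => i; exact: mA.
apply/seteqP; split=> [[x y] /= Axy|[x y] /= [Ax Ay] i].
  by split=> [|i]; [have := Axy ord0 | have := Axy (lift ord0 i); rewrite tnthS].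
by case: (unliftP ord0 i) => [j ->|-> //]; rewrite tnthS.
Qed.

End power_measure.

Section lebesgue.
Variable R : realType.

Definition lebesgue (d : nat) :
    {measure set (d.-tuple (measurableTypeR R)) -> \bar R} :=
  power_measure (@lebesgue_measure R) d.

Definition cube (d : nat) : set (d.-tuple (measurableTypeR R)) :=
  [set x | forall i, 0 <= tnth x i < 1].

Definition L1norm (d : nat) (f : d.-tuple (measurableTypeR R) -> R) : \bar R :=
  ('N[lebesgue d]_1[EFin \o f])%E.

(* A density on [0, 1)^d is represented by its extension by zero to R^d, so
   that integrals over R^d are integrals over the cube. *)
Record density (d : nat) := Density {
  pdf :> d.-tuple (measurableTypeR R) -> R ;
  measurable_pdf : measurable_fun setT pdf ;
  pdf_ge0 : forall x, 0 <= pdf x ;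
  pdf_out : forall x, ~ cube x -> pdf x = 0 ;
  integral_pdf : (\int[lebesgue d]_x (pdf x)%:E = 1)%E }.

End lebesgue.

Section law.
Local Open Scope ereal_scope.
Context {R : realType} {d : nat}.
Variable p : density R d.

Definition law (A : set (d.-tuple (measurableTypeR R))) : \bar R :=
  \int[lebesgue R d]_(x in A) (p x)%:E.

Let law0 : law set0 = 0.
Proof. by rewrite /law integral_set0. Qed.

Let law_ge0 A : 0 <= law A.
Proof. by apply: integral_ge0 => x _; rewrite lee_fin pdf_ge0. Qed.

Let law_sigma_additive : semi_sigma_additive law.
Proof.
move=> F mF tF mUF; rewrite /law; apply: cvg_toP.
  apply: ereal_nondecreasing_is_cvgn => a b ab.
  apply: lee_sum_nneg_natr => // k _ _.
  by apply: integral_ge0 => x _; rewrite lee_fin pdf_ge0.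
rewrite ge0_integral_bigcup//=.
- apply/measurable_EFinP.
  exact: measurable_funS (@subsetT _ _) (measurable_pdf p).
- by move=> x _; rewrite lee_fin pdf_ge0.
Qed.

HB.instance Definition _ := isMeasure.Build _ _ _ law
  law0 law_ge0 law_sigma_additive.

Let law_setT : law [set: _] = 1.
Proof. by rewrite /law integral_pdf. Qed.

HB.instance Definition _ := Measure_isProbability.Build _ _ _ law law_setT.

(* Joint law of X_1, ..., X_n iid with density p. *)
Definition sample_law (n : nat) :
    {measure set (n.-tuple (d.-tuple (measurableTypeR R))) -> \bar R} :=
  power_measure law n.

End law.

Section tucker_histograms.
Variable R : realType.

Definition probability_vector (I : finType) (w : I -> R) : Prop :=
  (forall i, 0 <= w i) /\ \sum_i w i = 1.

Definition bin_density (b : nat) (i : 'I_b) (x : R) : R :=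
  b%:R * \1_[set y : R | i%:R / b%:R <= y < i.+1%:R / b%:R] x.

Definition histogram1 (b : nat) : set (R -> R) :=
  [set f | exists w : 'I_b -> R, probability_vector w /\
           f = fun x => \sum_(i < b) w i * bin_density i x].

Definition tucker_histogram (d b k : nat) :
    set (d.-tuple (measurableTypeR R) -> R) :=
  [set q | exists (W : d.-tuple 'I_k -> R) (f : 'I_d -> 'I_k -> R -> R),
    [/\ probability_vector W,
        forall i j, histogram1 b (f i j) &
        q = fun x => \sum_(S : d.-tuple 'I_k)
              W S * \prod_(i < d) f i (tnth S i) (tnth x i)]].

End tucker_histograms.

Section estimators.
Context {R : realType} {d : nat}.

Definition samples (n : nat) : set (n.-tuple (d.-tuple (measurableTypeR R))) :=
  [set X | forall i, cube (tnth X i)].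

Definition L1open (U : set (d.-tuple (measurableTypeR R) -> R)) : Prop :=
  U `<=` [set f | f \in Lfun (lebesgue R d) 1%E] /\
  forall f, U f -> exists2 e : R, 0 < e &
    forall g, g \in Lfun (lebesgue R d) 1%E ->
      (L1norm (g \- f)%R < e%:E)%E -> U g.

(* Borel measurability of the map for the topology of the L1 norm; only the
   values on samples in the cube are constrained. *)
Definition estimator (n : nat) (H : set (d.-tuple (measurableTypeR R) -> R))
    (V : n.-tuple (d.-tuple (measurableTypeR R)) ->
         d.-tuple (measurableTypeR R) -> R) : Prop :=
  (forall X, samples X -> H (V X)) /\
  (forall U, L1open U -> measurable (@samples n `&` V @^-1` U)).

(* min_(q in H) ||p - q||: the infimum is attained when H is a set of Tucker
   histograms, which is a continuous image of a compact parameter set. *)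
Definition L1dist (H : set (d.-tuple (measurableTypeR R) -> R))
    (p : d.-tuple (measurableTypeR R) -> R) : \bar R :=
  ereal_inf [set L1norm (p \- q) | q in H].

End estimators.

(* Main.v *)
(* The estimator is the Devroye-Lugosi minimum distance estimate over a finite
   grid of Tucker histograms. Discretise the weights of a probability vector
   with m entries to multiples of 1/m^2 and put the rounding defect on one
   coordinate; with m = b for the one-dimensional histograms and m = k^d for the
   core tensor, every Tucker histogram is within
   2 (1 - (1 - k^-d) (1 - 1/b)^d) -> 0 of the grid, because it and a suitable
   grid point dominate a common subdensity of mass at least
   (1 - k^-d) (1 - 1/b)^d. For b, k^d >= 2 the grid has at most
   (k^d)^(3 k^d) b^(3 b d k) points, so its log-cardinality is negligible with
   respect to n under the rate assumption. Among candidates q_i, the one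
   minimising the maximal discrepancy between q_i and the empirical measure over
   the sets {q_a > q_b} is within 3 min_j |q_j - p| + 4 Delta of p, where Delta
   is the maximal deviation of the empirical measure from p on these sets;
   Chernoff's bound and a union bound show that Delta -> 0 in probability. *)
Require Import Defs.
From mathcomp Require Import all_boot all_order all_algebra.
From mathcomp Require Import all_classical all_reals all_analysis.
From mathcomp Require Import measurable_realfun ring lra zify.
Import Order.TTheory GRing.Theory Num.Theory.
Import numFieldNormedType.Exports.
Local Open Scope classical_set_scope.
Local Open Scope ring_scope.

Set Implicit Arguments.
Unset Strict Implicit.
Unset Printing Implicit Defensive.

(** * Binomial tails and rounding of probability vectors *)

(** Since [expR (- x)] is at least [1 - x], [expR x] is at most [1 / (1 - x)], and [(1 - x) (1 + x +
    2 x^2) = 1 + x^2 (1 - 2 x)] is at least 1. *)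
Lemma expR_le_quadratic (R : realType) (x : R) :
  x <= 2^-1 -> expR x <= 1 + x + 2 * x ^+ 2.
Proof.
move=> x_le; have x_lt1 : 0 < 1 - x by lra.
have expN : 1 - x <= expR (- x) by have := expR_ge1Dx (- x).
apply: (@le_trans _ _ (1 - x)^-1).
  by rewrite -(invrK (expR x)) -expRN lef_pV2 ?posrE ?expR_gt0.
rewrite -div1r ler_pdivrMr//.
have : 0 <= x ^+ 2 * (1 - 2 * x) by rewrite mulr_ge0 ?sqr_ge0//; lra.
by nra.
Qed.

Definition bernoulli_weight {R : realType} (a : R) (c : bool) : R :=
  if c then a else 1 - a.

(** After [expR (- (s * t))] is factored out, the quadratic bounds for the two outcomes are
    averaged: their linear terms cancel and the rest is [1 + 2 s^2 a (1 - a)], at most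
    [expR (2 * s ^+ 2)]. *)
Lemma bernoulli_mgf (R : realType) (a s t : R) :
  0 <= a <= 1 -> 0 <= s <= 2^-1 ->
  \sum_(c : bool) bernoulli_weight a c * expR (s * (c%:R - (a + t))) <=
  expR (2 * s ^+ 2 - s * t).
Proof.
move=> /andP[a0 a1] /andP[s0 s1].
have -> : 2 * s ^+ 2 - s * t = - (s * t) + 2 * s ^+ 2 by ring.
rewrite big_bool/= /bernoulli_weight expRD.
have -> : s * (true%:R - (a + t)) = - (s * t) + s * (1 - a) :> R by rewrite /=; ring.
have -> : s * (false%:R - (a + t)) = - (s * t) + - (s * a) :> R by rewrite /=; ring.
rewrite !expRD !(mulrCA _ (expR (- (s * t)))) -mulrDr ler_wpM2l ?expR_ge0//.
have e1 : expR (s * (1 - a)) <= 1 + s * (1 - a) + 2 * (s * (1 - a)) ^+ 2.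
  by apply: expR_le_quadratic; nra.
have e2 : expR (- (s * a)) <= 1 + - (s * a) + 2 * (- (s * a)) ^+ 2.
  by apply: expR_le_quadratic; nra.
apply: le_trans (expR_ge1Dx _).
have b0 : 0 <= 1 - a by lra.
apply: le_trans (lerD (ler_wpM2l a0 e1) (ler_wpM2l b0 e2)) _.
rewrite [leLHS](_ : _ = 1 + 2 * s ^+ 2 * (a * (1 - a))); last by ring.
rewrite lerD2l ler_piMr ?mulr_ge0 ?sqr_ge0//.
by nra.
Qed.

(* Chernoff's method with the exponent [t / 4]. *)
Lemma bernoulli_tail (R : realType) (n : nat) (a t : R) :
  0 <= a <= 1 -> 0 <= t <= 2 ->
  \sum_(B : {ffun 'I_n -> bool} | n%:R * (a + t) <= \sum_(l < n) (B l)%:R)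
     \prod_(l < n) bernoulli_weight a (B l) <=
  expR (- (n%:R * t ^+ 2 / 8)).
Proof.
move=> a01 /andP[t0 t2].
have w0 c : 0 <= bernoulli_weight a c.
  by case/andP: a01; case: c; rewrite /bernoulli_weight; lra.
set s := t / 4.
set G := fun c : bool => bernoulli_weight a c * expR (s * (c%:R - (a + t))).
have G0 c : 0 <= G c by rewrite mulr_ge0 ?expR_ge0.
have prodG (B : {ffun 'I_n -> bool}) : \prod_(l < n) G (B l) =
    \prod_(l < n) bernoulli_weight a (B l) *
    expR (s * (\sum_(l < n) (B l)%:R - n%:R * (a + t))).
  rewrite big_split/= -expR_sum -mulr_sumr sumrB; congr (_ * expR (_ * (_ - _))).
  by rewrite sumr_const card_ord mulr_natl.
apply: (@le_trans _ _ (\sum_(B : {ffun 'I_n -> bool}) \prod_(l < n) G (B l))).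
  rewrite big_mkcond/=; apply: ler_sum => B _.
  case: ifPn => [Bge|_]; last by apply: prodr_ge0.
  rewrite prodG ler_peMr//; first exact: prodr_ge0.
  rewrite -[leLHS]expR0 ler_expR; apply: mulr_ge0; last by rewrite subr_ge0.
  by rewrite /s; lra.
(* Independence: the sum over 0/1 vectors factors into [n] equal one-trial sums. *)
rewrite -(bigA_distr_bigA (fun _ => G)) prodr_const card_ord.
have sle : 0 <= s <= 2^-1 by rewrite /s; apply/andP; split; lra.
have mgf : \sum_c G c <= expR (2 * s ^+ 2 - s * t) by exact: bernoulli_mgf.
(* The value [s = t / 4] minimises [2 s^2 - s t], with minimum [- t^2 / 8]; [t <= 2] is what keeps
   [s] within [2^-1]. *)
have -> : - (n%:R * t ^+ 2 / 8) = n%:R * (2 * s ^+ 2 - s * t).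
  by rewrite /s; field.
rewrite expRM_natl; apply: lerXn2r => //; rewrite nnegrE ?expR_ge0//.
by apply: sumr_ge0.
Qed.

(** * A finite grid in the probability simplex *)

Section simplex_grid.
Context {R : realType} {A : finType}.
Variables (a0 : A) (m : nat).

(** Codes with total above [m] are sent to the point mass at [a0], so that every [u] codes a
    probability vector and the grid is indexed by a whole finite type. *)
Definition grid_vector (u : {ffun A -> 'I_m.+1}) (a : A) : R :=
  if (\sum_a u a <= m)%N
  then ((u a)%:R + (a == a0)%:R * (m - \sum_a u a)%:R) / m%:R
  else (a == a0)%:R.

Lemma grid_vector_prob (u : {ffun A -> 'I_m.+1}) : (0 < m)%N ->
  probability_vector (grid_vector u).
Proof.
move=> m0; split=> [a|].
  by rewrite /grid_vector; case: ifP => // _; rewrite divr_ge0 ?addr_ge0 ?mulr_ge0.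
have sum_a0 (c : R) : \sum_a (a == a0)%:R * c = c.
  rewrite (bigD1 a0)//= eqxx mul1r big1 ?addr0// => a /negPf ->.
  by rewrite mul0r.
rewrite /grid_vector; case: (boolP (\sum_a u a <= m)%N) => [um|_].
  rewrite -mulr_suml big_split/= sum_a0 -natr_sum -natrD subnKC//.
  by rewrite divff// pnatr_eq0 -lt0n.
by rewrite -[RHS](sum_a0 1); apply: eq_bigr => a _; rewrite mulr1.
Qed.

(** Take [u a] to be the integer part of [m w a] and [v = u / m]. Each entry loses less than
    [1 / m], and the defect added at [a0] only increases the grid point. *)
Lemma grid_vector_approx (w : A -> R) : (0 < m)%N -> probability_vector w ->
  exists (u : {ffun A -> 'I_m.+1}) (v : A -> R),
    [/\ forall a, 0 <= v a <= w a,
        forall a, v a <= grid_vector u a &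
        1 - #|A|%:R / m%:R <= \sum_a v a].
Proof.
move=> m0 [w0 w1].
have mR : 0 < m%:R :> R by rewrite ltr0n.
have mw0 a : 0 <= m%:R * w a by rewrite mulr_ge0.
pose f a := Num.truncn (m%:R * w a).
have f_le a : (f a)%:R <= m%:R * w a by have /andP[] := truncn_itv (mw0 a).
have f_gt a : m%:R * w a < (f a).+1%:R by have /andP[] := truncn_itv (mw0 a).
have sumf : (\sum_a f a <= m)%N.
  rewrite -(ler_nat R) natr_sum (le_trans (ler_sum _ (fun a _ => f_le a)))//.
  by rewrite -mulr_sumr w1 mulr1.
have fm a : (f a < m.+1)%N.
  by rewrite ltnS (leq_trans _ sumf)// (bigD1 a)//= leq_addr.
exists [ffun a => inord (f a)], (fun a => (f a)%:R / m%:R).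
have valf a : nat_of_ord ([ffun a => inord (f a)] a : 'I_m.+1) = f a.
  by rewrite ffunE inordK.
have sumE : (\sum_a ([ffun a => inord (f a)] a : 'I_m.+1) = \sum_a f a)%N.
  by apply: eq_bigr => a _.
split=> [a|a|].
- by rewrite divr_ge0//= ler_pdivrMr// mulrC.
- rewrite /grid_vector sumE sumf valf ler_pM2r ?invr_gt0// lerDl mulr_ge0//.
- rewrite -mulr_suml ler_pdivlMr// mulrBl mul1r mulfVK ?gt_eqF//.
  rewrite lerBlDr (_ : m%:R = \sum_a m%:R * w a); last first.
    by rewrite -mulr_sumr w1 mulr1.
  rewrite (_ : #|A|%:R = \sum_(a : A) 1); last by rewrite sumr_const.
  rewrite -big_split/=.
  by apply: ler_sum => a _; rewrite natr1 ltW.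
Qed.

End simplex_grid.

(** * Minimum distance estimates *)

Section minimum_distance.
Context d (T : measurableType d) (R : realType) (mu : {measure set T -> \bar R}).
Local Notation integrable f := (mu.-integrable setT (EFin \o f)).

Lemma integrable_normr (f : T -> R) :
  integrable f -> integrable (fun x => `|f x|).
Proof. by move=> /integrable_abse. Qed.

Lemma integrable_subr (f g : T -> R) :
  integrable f -> integrable g -> integrable (fun x => f x - g x).
Proof. by move=> fi gi; apply: eq_integrable (integrableB _ fi gi). Qed.

Lemma integrable_restrict (f : T -> R) (A : set T) : measurable A ->
  integrable f -> mu.-integrable A (EFin \o f).
Proof. by move=> mA; apply: integrableS. Qed.

Lemma Rintegral_setC (f : T -> R) (A : set T) : measurable A -> integrable f ->
  \int[mu]_x f x = \int[mu]_(x in A) f x + \int[mu]_(x in ~` A) f x.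
Proof.
move=> mA fi; rewrite -(setUv A) Rintegral_setU ?setUv//.
  exact: measurableC.
by rewrite disj_set2E setICr.
Qed.

Lemma Rintegral_normrD (f g : T -> R) : integrable f -> integrable g ->
  \int[mu]_x `|f x + g x| <= \int[mu]_x `|f x| + \int[mu]_x `|g x|.
Proof.
move=> fi gi; rewrite -RintegralD//; try exact: integrable_normr.
apply: le_Rintegral => //.
- apply: integrable_normr.
  by apply: eq_integrable (integrableD _ fi gi).
- by apply: eq_integrable (integrableD _ (integrable_normr fi) (integrable_normr gi)).
- by move=> x _; exact: ler_normD.
Qed.

(** The integrals over [A] and its complement are opposite, and each is bounded in absolute value by
    the integral of [|f|] over its own part. *)
Lemma scheffe_le (f : T -> R) (A : set T) : measurable A -> integrable f ->
  \int[mu]_x f x = 0 -> 2 * `|\int[mu]_(x in A) f x| <= \int[mu]_x `|f x|.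
Proof.
move=> mA fi f0.
have mAc : measurable (~` A) by exact: measurableC.
have nfi := integrable_normr fi.
have := Rintegral_setC mA fi; rewrite f0 => fAc.
rewrite (Rintegral_setC mA nfi) mulr_natl mulr2n lerD//.
  by apply: le_normr_Rintegral => //; exact: integrable_restrict.
rewrite (_ : \int[mu]_(x in A) f x = - \int[mu]_(x in ~` A) f x); last by lra.
by rewrite normrN; apply: le_normr_Rintegral => //; exact: integrable_restrict.
Qed.

(** Equality holds in [scheffe_le] for this set, because [f] has constant sign on it and on its
    complement. *)
Lemma scheffe_eq (f : T -> R) : measurable [set x | 0 < f x] ->
  integrable f -> \int[mu]_x f x = 0 ->
  \int[mu]_x `|f x| = 2 * \int[mu]_(x in [set x | 0 < f x]) f x.
Proof.
move=> mA fi f0; set A := [set x | 0 < f x].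
have mAc : measurable (~` A) by exact: measurableC.
have := Rintegral_setC mA fi; rewrite f0 => fAc.
rewrite (Rintegral_setC mA (integrable_normr fi)).
rewrite (@eq_Rintegral _ _ _ mu A f); last first.
  by move=> x /[!inE] /= /gtr0_norm.
rewrite (@eq_Rintegral _ _ _ mu (~` A) (fun x => -1 * f x)); last first.
  by move=> x /[!inE] /= /negP; rewrite -leNgt mulN1r => /ler0_norm.
by rewrite RintegralZl//; [lra|exact: integrable_restrict].
Qed.

(* The Devroye-Lugosi bound for the minimum distance estimate over the Yatracos
   class of the candidates [q], with [nu] in the role of the empirical
   measure. *)
Lemma minimum_distance_bound (I : finType) (q : I -> T -> R) (p : T -> R)
  (nu : I * I -> R) (e : R) (i0 j : I) :
  let A (ab : I * I) := [set x | q ab.2 x < q ab.1 x] in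
  let err i := \big[Num.max/0]_(ab : I * I)
                 `|\int[mu]_(x in A ab) q i x - nu ab| in
  integrable p -> (forall i, integrable (q i)) ->
  (forall i, \int[mu]_x q i x = \int[mu]_x p x) ->
  (forall ab, measurable (A ab)) ->
  (forall ab, `|nu ab - \int[mu]_(x in A ab) p x| <= e) ->
  (forall i, err i0 <= err i) ->
  \int[mu]_x `|q i0 x - p x| <= 3 * \int[mu]_x `|q j x - p x| + 4 * e.
Proof.
move=> A err int_p qi qp mA nue min_i0.
pose D := \int[mu]_x `|q j x - p x|.
have D0 : 0 <= D by apply: Rintegral_ge0.
have e0 : 0 <= e by exact: le_trans (nue (i0, i0)).
(* By Scheffé, the masses that [q j] and [p] give to a set differ by at most half their L1
   distance. *)
have err_j : err j <= D / 2 + e.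
  rewrite /err; apply: bigmax_le => [|ab _].
    by rewrite addr_ge0// divr_ge0.
  have -> : \int[mu]_(x in A ab) q j x - nu ab =
      (\int[mu]_(x in A ab) q j x - \int[mu]_(x in A ab) p x) -
      (nu ab - \int[mu]_(x in A ab) p x) by ring.
  apply: le_trans (ler_normB _ _) _; apply: lerD => //.
  rewrite -RintegralB//; try exact: integrable_restrict.
  rewrite ler_pdivlMr// mulrC.
  apply: (@scheffe_le (fun x => q j x - p x)) => //; first exact: integrable_subr.
  by rewrite RintegralB// qp subrr.
have err_le i ab : `|\int[mu]_(x in A ab) q i x - nu ab| <= err i.
  exact: (le_bigmax _ (fun ab => `|\int[mu]_(x in A ab) q i x - nu ab|)).
(* The Yatracos set of [(i0, j)] is where [q i0 - q j] is positive, so Scheffé's identity applies to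
   it. There the two masses differ by at most [err i0 + err j <= 2 * err j <= D + 2 * e]; the factor
   2 of the identity gives the bound, and the triangle inequality then adds one more [D]. *)
have qq : \int[mu]_x `|q i0 x - q j x| <= 2 * D + 4 * e.
  have AE : [set x | 0 < q i0 x - q j x] = A (i0, j).
    by apply/seteqP; split => x /=; rewrite subr_gt0.
  rewrite scheffe_eq ?AE//; last 2 first.
  - exact: integrable_subr.
  - by rewrite RintegralB// !qp subrr.
  rewrite RintegralB//; try exact: integrable_restrict.
  have := err_le i0 (i0, j); have := err_le j (i0, j); have := min_i0 j.
  by rewrite !ler_norml => ? /andP[? ?] /andP[? ?]; lra.
have := Rintegral_normrD (integrable_subr (qi i0) (qi j)) (integrable_subr (qi j) int_p).
under eq_Rintegral do rewrite subrKA.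
by rewrite -/D; lra.
Qed.

End minimum_distance.

(** * Deviations of the empirical measure *)

Section finite_unions.
Context d (T : measurableType d) (R : realType).

Lemma measure_bigsetU_le (mu : {measure set T -> \bar R}) (I : Type)
  (s : seq I) (Q : pred I) (F : I -> set T) :
  (forall i, Q i -> measurable (F i)) ->
  (mu (\big[setU/set0]_(i <- s | Q i) F i) <= \sum_(i <- s | Q i) mu (F i))%E.
Proof.
move=> mF; elim: s => [|i s IHs]; first by rewrite !big_nil measure0.
rewrite !big_cons; case: ifP => // Qi.
apply: le_trans (measureU2 _ _ _) _; first exact: mF.
  exact: bigsetU_measurable.
by rewrite leeD2l.
Qed.

Lemma preimage_fintypeE (D : finType) (f : T -> D) (S : set D) :
  f @^-1` S = \big[setU/set0]_(c | `[< S c >]) f @^-1` [set c].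
Proof.
rewrite -bigcup_seq_cond; apply/seteqP; split => x /=.
  by move=> Sx; exists (f x) => //=; rewrite mem_index_enum; exact/asboolP.
by move=> [c /= /andP[_ /asboolP Sc] ->].
Qed.

Lemma measurable_preimage_fintype (D : finType) (f : T -> D) (S : set D) :
  (forall c, measurable (f @^-1` [set c])) -> measurable (f @^-1` S).
Proof.
by move=> mf; rewrite preimage_fintypeE; apply: bigsetU_measurable.
Qed.

End finite_unions.

Section samples.
Context disp (T : measurableType disp) (R : realType) (P : probability T R).
Variable n : nat.

(** Everything the estimator reads from the sample: empirical measures of the sets [E j] are
    functions of this finite record, so measurability reduces to that of its fibres. *)
Definition membership_pattern (J : finType) (E : J -> set T)
    (X : n.-tuple T) : {ffun 'I_n * J -> bool} :=
  [ffun lj => tnth X lj.1 \in E lj.2].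

(** A fibre is a box: each sample point is confined to a finite intersection of sets [E j] and
    complements. *)
Lemma measurable_membership_pattern (J : finType) (E : J -> set T)
    (S : set {ffun 'I_n * J -> bool}) :
  (forall j, measurable (E j)) ->
  measurable (membership_pattern E @^-1` S).
Proof.
move=> mE; apply: measurable_preimage_fintype => c.
pose F (l : 'I_n) := \bigcap_(j in [set: J]) (if c (l, j) then E j else ~` E j).
rewrite (_ : _ @^-1` _ = [set X | forall l, F l (tnth X l)]).
  apply: (measurable_box (A := F)) => l.
  apply: fin_bigcap_measurable => [|j _]; first exact: finite_finset.
  by case: ifP => // _; exact: measurableC.
apply/seteqP; split => [X /= Xc l j _|X /= cX].
  by rewrite -Xc ffunE/=; case: ifPn; rewrite ?notin_setE ?inE.
apply/ffunP => -[l j]; rewrite ffunE/=.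
by have := cX l j Logic.I; case: ifP => _ ?; [rewrite mem_set|rewrite memNset].
Qed.

(** The event is a disjoint union of fibres of the 0/1 vector of memberships in [A]; each fibre is a
    box whose probability is a product of Bernoulli weights, which leads to [bernoulli_tail]. *)
Lemma sample_upper_tail (A : set T) (t : R) : measurable A -> 0 <= t <= 2 ->
  (power_measure P n [set X : n.-tuple T |
     (n%:R * (fine (P A) + t) <= \sum_(l < n) (tnth X l \in A)%:R)%R] <=
   (expR (- (n%:R * t ^+ 2 / 8)))%:E)%E.
Proof.
move=> mA t02; set a := fine (P A).
have aE : P A = a%:E by rewrite fineK// fin_num_measure.
have a01 : 0 <= a <= 1.
  by rewrite -!lee_fin -aE measure_ge0 probability_le1.
pose f (X : n.-tuple T) : {ffun 'I_n -> bool} := [ffun l => tnth X l \in A].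
pose F (c : bool) := if c then A else ~` A.
have mF c : measurable (F c) by case: c => //; exact: measurableC.
have PF c : P (F c) = (bernoulli_weight a c)%:E.
  case: c; rewrite /F /bernoulli_weight//.
  by rewrite probability_setC// aE.
have fE c : f @^-1` [set c] = [set X : n.-tuple T | forall l, F (c l) (tnth X l)].
  apply/seteqP; split => [X /= <- l|X /= cX].
    by rewrite ffunE/= /F; case: ifPn; rewrite ?notin_setE ?inE.
  apply/ffunP => l; rewrite ffunE/=.
  by have := cX l; rewrite /F; case: ifP => _ ?; [rewrite mem_set|rewrite memNset].
have sumE X : \sum_(l < n) (f X l)%:R = \sum_(l < n) (tnth X l \in A)%:R :> R.
  by apply: eq_bigr => l _; rewrite ffunE.
rewrite (_ : [set X | _] = f @^-1`
    [set B : {ffun 'I_n -> bool} | n%:R * (a + t) <= \sum_(l < n) (B l)%:R]);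
  last by apply/seteqP; split => X /=; rewrite sumE.
rewrite preimage_fintypeE; apply: le_trans (measure_bigsetU_le _ _ _) _.
  by move=> c _; rewrite fE; exact: (measurable_box (A := fun l => F (c l))).
apply: (@le_trans _ _ (\sum_(B : {ffun 'I_n -> bool} |
    n%:R * (a + t) <= \sum_(l < n) (B l)%:R)
     \prod_(l < n) bernoulli_weight a (B l))%:E); last first.
  by rewrite lee_fin; exact: bernoulli_tail.
rewrite -sumEFin; under eq_bigl do rewrite /= asboolb.
apply: lee_sum => B _; rewrite fE (power_measure_box P (A := fun l => F (B l)))// -prodEFin.
by rewrite (eq_bigr (fun l => (bernoulli_weight a (B l))%:E)) // => l _; exact: PF.
Qed.

Definition empirical (X : n.-tuple T) (A : set T) : R :=
  (\sum_(l < n) (tnth X l \in A)%:R) / n%:R.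

Lemma measurable_sample_tail (A : set T) (c : R) : measurable A ->
  measurable [set X : n.-tuple T | c <= \sum_(l < n) (tnth X l \in A)%:R].
Proof.
move=> mA; rewrite (_ : [set X | _] = membership_pattern (fun _ : unit => A) @^-1`
    [set B : {ffun 'I_n * unit -> bool} | c <= \sum_(l < n) (B (l, tt))%:R]).
  exact: measurable_membership_pattern.
have sumE X : \sum_(l < n) (membership_pattern (fun _ : unit => A) X (l, tt))%:R =
    \sum_(l < n) (tnth X l \in A)%:R :> R.
  by apply: eq_bigr => l _; rewrite ffunE.
by apply/seteqP; split=> X /=; rewrite sumE.
Qed.

(** Union bound over [J] and over the two tails. The set [W] is any measurable part of the deviation
    event, so that the failure event of an estimator can be substituted for it. *)
Lemma uniform_deviation (J : finType) (E : J -> set T) (t : R)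
    (W : set (n.-tuple T)) : (0 < n)%N -> (forall j, measurable (E j)) ->
  0 <= t <= 2 -> measurable W ->
  W `<=` [set X | exists j, t < `|empirical X (E j) - fine (P (E j))|] ->
  (power_measure P n W <= (#|J|%:R * (2 * expR (- (n%:R * t ^+ 2 / 8))))%:E)%E.
Proof.
move=> n0 mE t02 mW WE.
pose U A : set (n.-tuple T) :=
  [set X | n%:R * (fine (P A) + t) <= \sum_(l < n) (tnth X l \in A)%:R].
have mU A : measurable A -> measurable (U A) by exact: measurable_sample_tail.
have mEc j : measurable (~` E j) by exact: measurableC.
(* A lower deviation on [E j] is an upper deviation on its complement. *)
have WU : W `<=` \big[setU/set0]_(j : J) (U (E j) `|` U (~` E j)).
  move=> X /WE[j]; rewrite -bigcup_seq => jX.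
  exists j => /=; first exact: mem_index_enum.
  have PC : fine (P (~` E j)) = 1 - fine (P (E j)).
    by rewrite probability_setC// fineB ?fin_num_measure.
  have nR : 0 < n%:R :> R by rewrite ltr0n.
  have SC : \sum_(l < n) (tnth X l \in ~` E j)%:R =
      n%:R - \sum_(l < n) (tnth X l \in E j)%:R :> R.
    rewrite -[X in X%:R - _]card_ord -sumr_const -sumrB; apply: eq_bigr => l _.
    by rewrite in_setC; case: (_ \in _); rewrite ?subrr ?subr0.
  move: jX; rewrite /empirical /U /= SC PC.
  set s := \sum_(l < n) _; set a := fine _ => /ltW.
  have -> : s / n%:R - a = (s - n%:R * a) / n%:R by field; rewrite gt_eqF.
  rewrite normrM (gtr0_norm (_ : 0 < n%:R^-1)) ?invr_gt0// ler_pdivlMr//.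
  by rewrite ler_normr => /orP[|] h; [left|right]; lra.
apply: le_trans (le_measure _ _ _ WU) _; rewrite ?inE//.
  by apply: bigsetU_measurable => j _; apply: measurableU; exact: mU.
apply: le_trans (measure_bigsetU_le _ _ _) _.
  by move=> j _; apply: measurableU; exact: mU.
have -> : (#|J|%:R * (2 * expR (- (n%:R * t ^+ 2 / 8))))%:E =
    (\sum_(j : J) (2 * expR (- (n%:R * t ^+ 2 / 8)))%:E)%E.
  by rewrite sumEFin sumr_const; congr EFin; exact: mulr_natl.
apply: lee_sum => j _; apply: le_trans (measureU2 _ _ _) _; try exact: mU.
by rewrite mulr_natl mulr2n EFinD leeD//; exact: sample_upper_tail.
Qed.

End samples.

(** * Tucker histograms *)

Section tucker.
Context {R : realType} {d b k : nat}.
Local Notation T := (d.-tuple (measurableTypeR R)).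
Local Notation mu := (lebesgue R d).

(** The weights are arbitrary reals, so that the subdensities obtained by rounding down have the
    same form as the histograms. *)
Definition tucker_fun (W : d.-tuple 'I_k -> R) (w : 'I_d -> 'I_k -> 'I_b -> R)
    (x : T) : R :=
  \sum_S W S * \prod_(i < d) \sum_(c < b) w i (tnth S i) c * bin_density c (tnth x i).

(** For nonnegative weights this is the integral of [tucker_fun W w]. *)
Definition tucker_mass (W : d.-tuple 'I_k -> R) (w : 'I_d -> 'I_k -> 'I_b -> R) : R :=
  \sum_S W S * \prod_(i < d) \sum_(c < b) w i (tnth S i) c.

Lemma tucker_histogramP (q : T -> R) : tucker_histogram b k q <->
  exists (W : d.-tuple 'I_k -> R) (w : 'I_d -> 'I_k -> 'I_b -> R),
    [/\ probability_vector W, forall i j, probability_vector (w i j) &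
        q = tucker_fun W w].
Proof.
split=> [[W [f [W1 fH ->]]]|[W [w [W1 w1 ->]]]].
  have [w /= wH] := choice (fun ij : 'I_d * 'I_k => fH ij.1 ij.2).
  exists W, (fun i j => w (i, j)); split=> [//|i j|].
    by have [] := wH (i, j).
  apply/funext => x; apply: eq_bigr => S _; congr (_ * _); apply: eq_bigr => i _.
  by have [_ /= ->] := wH (i, tnth S i).
exists W, (fun i j x => \sum_(c < b) w i j c * bin_density c x).
by split=> // i j; exists (w i j).
Qed.

Lemma bin_density_ge0 (c : 'I_b) (x : R) : 0 <= bin_density c x.
Proof. by rewrite mulr_ge0. Qed.

Lemma tucker_fun_le (W V : d.-tuple 'I_k -> R) (w v : 'I_d -> 'I_k -> 'I_b -> R) x :
  (forall S, 0 <= V S <= W S) -> (forall i j c, 0 <= v i j c <= w i j c) ->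
  0 <= tucker_fun V v x <= tucker_fun W w x.
Proof.
move=> VW vw.
have le0 i j c y : 0 <= v i j c * bin_density c y <= w i j c * bin_density c y.
  have /andP[v0 ?] := vw i j c.
  by rewrite mulr_ge0 ?bin_density_ge0//= ler_wpM2r ?bin_density_ge0.
have s0 (S : d.-tuple 'I_k) i :
    0 <= \sum_(c < b) v i (tnth S i) c * bin_density c (tnth x i).
  by apply: sumr_ge0 => c _; case/andP: (le0 i (tnth S i) c (tnth x i)).
apply/andP; split; [apply: sumr_ge0|apply: ler_sum] => S _; have /andP[V0 ?] := VW S.
  by rewrite mulr_ge0// prodr_ge0.
apply: ler_pM => //; first exact: prodr_ge0.
apply: ler_prod => i _; rewrite s0/=; apply: ler_sum => c _.
by case/andP: (le0 i (tnth S i) c (tnth x i)).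
Qed.

(** Distributing the product over the bins gives a combination of products of bin densities, which
    are normalised indicators of cells; measurability and the integral are read off from this
    form. *)
Lemma tucker_fun_cellsE W w x : tucker_fun W w x =
  \sum_S \sum_(c : {ffun 'I_d -> 'I_b}) (W S * \prod_(i < d) w i (tnth S i) (c i)) *
     \prod_(i < d) bin_density (c i) (tnth x i).
Proof.
apply: eq_bigr => S _; rewrite bigA_distr_bigA mulr_sumr; apply: eq_bigr => c _.
by rewrite big_split/= mulrA.
Qed.

Lemma tucker_mass_cellsE W w : tucker_mass W w =
  \sum_S \sum_(c : {ffun 'I_d -> 'I_b}) (W S * \prod_(i < d) w i (tnth S i) (c i)).
Proof. by apply: eq_bigr => S _; rewrite bigA_distr_bigA mulr_sumr. Qed.

Definition cell (c : {ffun 'I_d -> 'I_b}) : set T :=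
  [set x | forall i, `[(c i)%:R / b%:R, (c i).+1%:R / b%:R[%classic (tnth x i)].

Lemma measurable_cell c : measurable (cell c).
Proof.
apply: (measurable_box (A := fun i =>
  `[(c i)%:R / b%:R, (c i).+1%:R / b%:R[%classic : set (measurableTypeR R))).
by move=> i; exact: measurable_itv.
Qed.

Lemma prod_bin_density (c : {ffun 'I_d -> 'I_b}) (x : T) :
  \prod_(i < d) bin_density (c i) (tnth x i) = b%:R ^+ d * \1_(cell c) x.
Proof.
rewrite /bin_density big_split/= prodr_const card_ord; congr (_ * _).
rewrite [RHS]indicE; have [xc|xc] := boolP (x \in cell c).
  rewrite big1// => i _; rewrite indicE mem_set//.
  by have := set_mem xc i; rewrite /= in_itv.
have /existsNP[i xi] : ~ cell c x by rewrite -notin_setE.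
by apply/eqP/prodf_eq0; exists i => //; rewrite indicE memNset.
Qed.

Hypothesis b_gt0 : (0 < b)%N.

Lemma lebesgue_cell c : mu (cell c) = (b%:R ^- d)%:E.
Proof.
pose F i : set (measurableTypeR R) :=
  `[(c i)%:R / b%:R, (c i).+1%:R / b%:R[%classic.
have muF i : lebesgue_measure (F i) = (b%:R^-1)%:E.
  rewrite lebesgue_measure_itv/= lte_fin ltr_pM2r ?invr_gt0 ?ltr0n//.
  by rewrite ltr_nat ltnSn -EFinB -mulrBl -natrB// subSnn mul1r.
rewrite /lebesgue (power_measure_box lebesgue_measure (A := F)); last first.
  by move=> i; exact: measurable_itv.
rewrite (eq_bigr (fun=> (b%:R^-1)%:E)); last by move=> i _; exact: muF.
by rewrite prodEFin prodr_const card_ord exprVn.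
Qed.

Lemma measurable_tucker_fun W w : measurable_fun setT (tucker_fun W w).
Proof.
rewrite (_ : tucker_fun W w = fun x => \sum_S \sum_(c : {ffun 'I_d -> 'I_b})
    (W S * \prod_(i < d) w i (tnth S i) (c i)) * (b%:R ^+ d * \1_(cell c) x)).
  apply: measurable_sum => S; apply: measurable_sum => c.
  do 2 apply: measurable_funM => //.
  by apply: measurable_indic; exact: measurable_cell.
by apply/funext => x; rewrite tucker_fun_cellsE;
  do 2 apply: eq_bigr => ? _; rewrite prod_bin_density.
Qed.

Lemma integral_tucker_fun W w : (forall S, 0 <= W S) -> (forall i j c, 0 <= w i j c) ->
  (\int[mu]_x (tucker_fun W w x)%:E = (tucker_mass W w)%:E)%E.
Proof.
move=> W0 w0.
have P0 S (c : {ffun 'I_d -> 'I_b}) : 0 <= W S * \prod_(i < d) w i (tnth S i) (c i).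
  by rewrite mulr_ge0 ?prodr_ge0.
have mI c : measurable_fun setT (fun x : T => (\1_(cell c) x)%:E : \bar R).
  by apply/measurable_EFinP/measurable_indic; exact: measurable_cell.
have t0 S (c : {ffun 'I_d -> 'I_b}) (x : T) :
    (0 <= ((W S * \prod_(i < d) w i (tnth S i) (c i)) * b%:R ^+ d)%:E *
          (\1_(cell c) x)%:E)%E.
  by rewrite -EFinM lee_fin mulr_ge0// mulr_ge0// exprn_ge0.
have mt S (c : {ffun 'I_d -> 'I_b}) : measurable_fun setT (fun x : T =>
    ((W S * \prod_(i < d) w i (tnth S i) (c i)) * b%:R ^+ d)%:E *
    (\1_(cell c) x)%:E)%E.
  by apply: measurable_funeM.
transitivity (\int[mu]_x \sum_S \sum_(c : {ffun 'I_d -> 'I_b})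
  (((W S * \prod_(i < d) w i (tnth S i) (c i)) * b%:R ^+ d)%:E * (\1_(cell c) x)%:E))%E.
  apply: eq_integral => x _; rewrite tucker_fun_cellsE.
  rewrite -sumEFin; apply: eq_bigr => S _; rewrite -sumEFin; apply: eq_bigr => c _.
  by rewrite prod_bin_density -EFinM mulrA.
rewrite ge0_integral_sum//=; last 2 first.
- by move=> S; apply: emeasurable_sum => c.
- by move=> S x _; apply: sume_ge0.
rewrite tucker_mass_cellsE -sumEFin; apply: eq_bigr => S _.
rewrite ge0_integral_sum//= -sumEFin; apply: eq_bigr => c _.
rewrite ge0_integralZl//=; last by rewrite lee_fin mulr_ge0.
rewrite integral_indic ?setIT ?lebesgue_cell//; last exact: measurable_cell.
by rewrite -EFinM mulfK// expf_neq0// pnatr_eq0 -lt0n.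
Qed.

Lemma integrable_tucker_fun W w : (forall S, 0 <= W S) -> (forall i j c, 0 <= w i j c) ->
  mu.-integrable setT (EFin \o tucker_fun W w).
Proof.
move=> W0 w0; apply/integrableP; split.
  by apply/measurable_EFinP; exact: measurable_tucker_fun.
under eq_integral => x _.
  have /andP[t0 _] : 0 <= tucker_fun W w x <= tucker_fun W w x.
    by apply: tucker_fun_le => [S|i j c]; rewrite lexx ?W0 ?w0.
  rewrite /= ger0_norm//; over.
by rewrite integral_tucker_fun// ltry.
Qed.

Lemma Rintegral_tucker_fun W w : (forall S, 0 <= W S) -> (forall i j c, 0 <= w i j c) ->
  \int[mu]_x tucker_fun W w x = tucker_mass W w.
Proof. by move=> W0 w0; rewrite /Rintegral integral_tucker_fun. Qed.

Lemma tucker_mass1 W w : probability_vector W -> (forall i j, probability_vector (w i j)) ->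
  tucker_mass W w = 1.
Proof.
move=> [_ W1] w1; rewrite -W1; apply: eq_bigr => S _; rewrite big1 ?mulr1// => i _.
by have [] := w1 i (tnth S i).
Qed.

Lemma tucker_mass_ge W w (e f : R) : 0 <= f <= 1 -> (forall S, 0 <= W S) ->
  1 - e <= \sum_S W S -> (forall i j, 1 - f <= \sum_c w i j c) ->
  (1 - e) * (1 - f) ^+ d <= tucker_mass W w.
Proof.
move=> /andP[f0 f1] W0 We wf.
apply: (@le_trans _ _ ((\sum_S W S) * (1 - f) ^+ d)).
  by rewrite ler_wpM2r// exprn_ge0// subr_ge0.
rewrite mulr_suml; apply: ler_sum => S _; rewrite ler_wpM2l//.
rewrite -[X in _ ^+ X]card_ord -prodr_const; apply: ler_prod => i _.
by rewrite subr_ge0 f1 wf.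
Qed.

(* Both functions dominate the subdensity [tucker_fun V v]. *)
Lemma tucker_fun_dist W W' V (w w' v : 'I_d -> 'I_k -> 'I_b -> R) :
  probability_vector W -> (forall i j, probability_vector (w i j)) ->
  probability_vector W' -> (forall i j, probability_vector (w' i j)) ->
  (forall S, 0 <= V S <= W S) -> (forall i j c, 0 <= v i j c <= w i j c) ->
  (forall S, V S <= W' S) -> (forall i j c, v i j c <= w' i j c) ->
  \int[mu]_x `|tucker_fun W w x - tucker_fun W' w' x| <= 2 * (1 - tucker_mass V v).
Proof.
move=> W1 w1 W'1 w'1 VW vw VW' vw'.
have [W0 _] := W1; have [W'0 _] := W'1.
have w0 i j c : 0 <= w i j c by have [] := w1 i j.
have w'0 i j c : 0 <= w' i j c by have [] := w'1 i j.
have V0 S : 0 <= V S by have /andP[] := VW S.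
have v0 i j c : 0 <= v i j c by have /andP[] := vw i j c.
have qi := integrable_tucker_fun W0 w0.
have q'i := integrable_tucker_fun W'0 w'0.
have ri := integrable_tucker_fun V0 v0.
have qri := integrable_subr qi ri; have q'ri := integrable_subr q'i ri.
(* If [r] lies below both [q] and [q'], then [|q - q'| <= (q - r) + (q' - r)], and each bracket
   integrates to 1 minus the mass of [r]. *)
apply: (@le_trans _ _ (\int[mu]_x ((tucker_fun W w x - tucker_fun V v x) +
                                  (tucker_fun W' w' x - tucker_fun V v x)))).
  apply: le_Rintegral => //.
  - exact/integrable_normr/integrable_subr.
  - by apply: eq_integrable (integrableD _ qri q'ri).
  move=> x _.
  have /andP[_ ?] := tucker_fun_le x VW vw.
  have /andP[_ ?] : 0 <= tucker_fun V v x <= tucker_fun W' w' x.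
    by apply: tucker_fun_le => *; apply/andP; split.
  by rewrite ler_norml; apply/andP; split; lra.
rewrite RintegralD// !RintegralB// !Rintegral_tucker_fun//.
by rewrite (tucker_mass1 W1 w1) (tucker_mass1 W'1 w'1); lra.
Qed.

End tucker.

(** * Selection over a grid of Tucker histograms *)

Section selection.
Context d (T : measurableType d) (R : realType) (mu : {measure set T -> \bar R}).
Context (I : finType) (q : I -> T -> R) (i0 : I) (n : nat).

Definition yatracos_set (ab : I * I) : set T := [set x | q ab.2 x < q ab.1 x].

Definition selection_error (X : n.-tuple T) (i : I) : R :=
  \big[Num.max/0]_(ab : I * I)
     `|\int[mu]_(x in yatracos_set ab) q i x - empirical R X (yatracos_set ab)|.

Definition selection (X : n.-tuple T) : I :=
  [arg min_(i < i0) selection_error X i]%O.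

Hypothesis measurable_yatracos : forall ab, measurable (yatracos_set ab).

(** The selected index depends on the sample only through the membership pattern of the Yatracos
    sets. *)
Lemma measurable_selection (S : set I) : measurable (selection @^-1` S).
Proof.
pose pat : n.-tuple T -> _ := membership_pattern yatracos_set.
pose emp (B : {ffun 'I_n * (I * I) -> bool}) ab : R :=
  (\sum_(l < n) (B (l, ab))%:R) / n%:R.
pose sel B := [arg min_(i < i0) \big[Num.max/0]_(ab : I * I)
     `|\int[mu]_(x in yatracos_set ab) q i x - emp B ab| ]%O.
have selE X : selection X = sel (pat X).
  have empE ab : emp (pat X) ab = empirical R X (yatracos_set ab).
    by congr (_ / _); apply: eq_bigr => l _; rewrite ffunE.
  rewrite /selection /sel; congr (Order.arg_min _ _ _); apply/funext => i.
  by apply: eq_bigr => ab _; rewrite empE.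
rewrite (_ : _ @^-1` _ = pat @^-1` (sel @^-1` S)).
  exact: measurable_membership_pattern.
by apply/seteqP; split => X /=; rewrite selE.
Qed.

Lemma selection_bound (p : T -> R) (e : R) (X : n.-tuple T) (j : I) :
  mu.-integrable setT (EFin \o p) ->
  (forall i, mu.-integrable setT (EFin \o q i)) ->
  (forall i, \int[mu]_x q i x = \int[mu]_x p x) ->
  (forall ab, `|empirical R X (yatracos_set ab) -
               \int[mu]_(x in yatracos_set ab) p x| <= e) ->
  \int[mu]_x `|q (selection X) x - p x| <= 3 * \int[mu]_x `|q j x - p x| + 4 * e.
Proof.
move=> int_p qi qp emp_e.
apply: (@minimum_distance_bound _ _ _ _ _ q p
  (fun ab => empirical R X (yatracos_set ab)) e (selection X) j) => // i.
rewrite /selection -/(selection_error X i).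
by case: arg_minP => // i1 _; apply.
Qed.

End selection.

(** * The finite cover of the Tucker histograms *)

Section cover.
Context {R : realType} {d b k : nat}.
Variables (c0 : 'I_b) (S0 : d.-tuple 'I_k).
Local Notation T := (d.-tuple (measurableTypeR R)).
Local Notation mu := (lebesgue R d).
Local Notation I := ({ffun d.-tuple 'I_k -> 'I_((k ^ d) ^ 2).+1} *
  {ffun 'I_d * 'I_k -> {ffun 'I_b -> 'I_(b ^ 2).+1}})%type.

Definition cover_density (u : I) : T -> R :=
  tucker_fun (grid_vector S0 u.1) (fun i j => grid_vector c0 (u.2 (i, j))).

Lemma card_cover : (2 <= b)%N -> (2 <= k ^ d)%N ->
  (#|{: I}| <= (k ^ d) ^ (3 * k ^ d) * b ^ (3 * (b * (d * k))))%N.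
Proof.
(* A coordinate takes [m^2 + 1] values; bounding this by [m^3] is the source of the exponents 3. *)
have sq3 m : (2 <= m)%N -> ((m ^ 2).+1 <= m ^ 3)%N by move=> m2; nia.
move=> b2 K2; rewrite card_prod !card_ffun card_prod !card_ord card_tuple card_ord.
have leq_expW m1 m2 e : (m1 <= m2)%N -> (m1 ^ e <= m2 ^ e)%N.
  by case: e => // e; rewrite leq_exp2r.
rewrite -(expnM (b ^ 2).+1) 2!(expnM _ 3).
apply: leq_mul; apply: leq_expW; exact: sq3.
Qed.

Lemma cover_density_prob (b0 : (0 < b)%N) (k0 : (0 < k)%N) (u : I) :
  probability_vector (@grid_vector R _ S0 _ u.1) /\
  forall i j, probability_vector (@grid_vector R _ c0 _ (u.2 (i, j))).
Proof.
by split=> *; apply: grid_vector_prob; rewrite expn_gt0 ?expn_gt0 ?k0 ?b0.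
Qed.

Definition cover_radius : R :=
  2 * (1 - (1 - (k ^ d)%:R^-1) * (1 - b%:R^-1) ^+ d).

Lemma cover_density_approx (q : T -> R) : (0 < b)%N -> (0 < k)%N ->
  tucker_histogram b k q ->
  exists u : I, \int[mu]_x `|q x - cover_density u x| <= cover_radius.
Proof.
move=> b0 k0 /tucker_histogramP[W [w [W1 w1 ->]]].
have K0 : (0 < k ^ d)%N by rewrite expn_gt0 k0.
have K20 : (0 < (k ^ d) ^ 2)%N by rewrite expn_gt0 K0.
have b20 : (0 < b ^ 2)%N by rewrite expn_gt0 b0.
(* Rounding [m] entries to multiples of [1 / m^2] loses mass at most [m / m^2 = 1 / m]. *)
have divsq m : m%:R / (m ^ 2)%:R = m%:R^-1 :> R.
  by rewrite natrX; have [->|m0] := eqVneq m 0%N; [rewrite mul0r invr0|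
    field; rewrite pnatr_eq0].
have [U [V [VW VU sumV]]] := grid_vector_approx S0 K20 W1.
have [u uP] := choice (fun ij : 'I_d * 'I_k =>
  grid_vector_approx c0 b20 (w1 ij.1 ij.2)).
have [v vP] := choice uP.
exists (U, [ffun ij => u ij]).
have [U1 u1] := cover_density_prob b0 k0 (U, [ffun ij => u ij]).
apply: le_trans (tucker_fun_dist (V := V) (v := fun i j => v (i, j))
  b0 W1 w1 U1 u1 VW _ VU _) _.
- by move=> i j c; have [] := vP (i, j).
- by move=> i j c; rewrite ffunE; have [] := vP (i, j).
rewrite /cover_radius ler_pM2l// lerD2l lerN2; apply: tucker_mass_ge.
- by rewrite invr_ge0 ler0n/= invf_le1 ?ltr0n// ler1n.
- by move=> S; have /andP[] := VW S.
- by move: sumV; rewrite card_tuple card_ord divsq.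
- by move=> i j; have [_ _] := vP (i, j); rewrite card_ord divsq.
Qed.

End cover.

(** * Densities and the unit cube *)

Section densities.
Context {R : realType} {d : nat}.
Local Notation T := (d.-tuple (measurableTypeR R)).
Local Notation mu := (lebesgue R d).

Lemma integrable_pdf (p : density R d) : mu.-integrable setT (EFin \o p).
Proof.
apply/integrableP; split.
  by apply/measurable_EFinP; exact: measurable_pdf.
under eq_integral do rewrite /= ger0_norm ?pdf_ge0//.
by rewrite integral_pdf ltry.
Qed.

Lemma Rintegral_pdf (p : density R d) : \int[mu]_x p x = 1.
Proof. by rewrite /Rintegral integral_pdf. Qed.

Lemma L1norm_Rintegral (f : T -> R) : mu.-integrable setT (EFin \o f) ->
  L1norm f = (\int[mu]_x `|f x|)%:E.
Proof.
move=> fi; rewrite /L1norm Lnorm1 /Rintegral fineK//.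
exact: integrable_fin_num (integrable_normr fi).
Qed.

Lemma cubeE : @cube R d = [set x | forall i : 'I_d,
  (`[0, 1[%classic : set (measurableTypeR R)) (tnth x i)].
Proof.
by apply/seteqP; split => x xC i; have := xC i; rewrite /= in_itv.
Qed.

Lemma measurable_cube : measurable (@cube R d).
Proof.
rewrite cubeE; apply: (measurable_box
  (A := fun=> (`[0, 1[%classic : set (measurableTypeR R)))).
by move=> i; exact: measurable_itv.
Qed.

Lemma lebesgue_cube : mu (@cube R d) = 1%E.
Proof.
rewrite cubeE.
have mu1 : lebesgue_measure (`[0, 1[%classic : set R) = 1%E.
  by rewrite lebesgue_measure_itv/= lte_fin ltr01 oppr0 adde0.
rewrite /lebesgue (power_measure_box lebesgue_measure
  (A := fun=> (`[0, 1[%classic : set (measurableTypeR R)))); last first.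
  by move=> i; exact: measurable_itv.
by rewrite big1// => i _; exact: mu1.
Qed.

Lemma measurable_samples n : measurable (@samples R d n).
Proof.
by apply: (measurable_box (A := fun=> @cube R d)) => _; exact: measurable_cube.
Qed.

Lemma uniform_density_measurable : measurable_fun setT (\1_(@cube R d) : T -> R).
Proof. by apply: measurable_indic; exact: measurable_cube. Qed.

Lemma uniform_density_integral :
  (\int[mu]_x (\1_(@cube R d) x : R)%:E = 1)%E.
Proof. by rewrite integral_indic ?setIT ?lebesgue_cube//; exact: measurable_cube. Qed.

(** A witness that densities exist, so that a supremum of probabilities over them is nonnegative. *)
Definition uniform_density : density R d.
Proof.
refine (@Density R d \1_(@cube R d) uniform_density_measurable _ _
  uniform_density_integral) => x.
  by rewrite indicE.
by move=> xC; rewrite indicE memNset.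
Defined.

End densities.

(** * Error and failure probability of the estimator *)

Section deviation.
Context {R : realType} {d b k : nat}.
Variables (b_gt0 : (0 < b)%N) (k_gt0 : (0 < k)%N).
Variables (c0 : 'I_b) (S0 : d.-tuple 'I_k) (n : nat).
Local Notation T := (d.-tuple (measurableTypeR R)).
Local Notation mu := (lebesgue R d).
Local Notation I := ({ffun d.-tuple 'I_k -> 'I_((k ^ d) ^ 2).+1} *
  {ffun 'I_d * 'I_k -> {ffun 'I_b -> 'I_(b ^ 2).+1}})%type.
Local Notation H := (@tucker_histogram R d b k).
Local Notation q := (@cover_density R d b k c0 S0).

Definition cover_estimator (X : n.-tuple T) : T -> R :=
  q (selection mu q ([ffun=> ord0], [ffun=> [ffun=> ord0]]) X).

Lemma integrable_cover_density (u : I) : mu.-integrable setT (EFin \o q u).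
Proof.
have [[U0 _] u0] := cover_density_prob (R := R) c0 S0 b_gt0 k_gt0 u.
by apply: (integrable_tucker_fun b_gt0 U0) => i j c; have [] := u0 i j.
Qed.

Lemma Rintegral_cover_density (u : I) : \int[mu]_x q u x = 1.
Proof.
have [U1 u1] := cover_density_prob (R := R) c0 S0 b_gt0 k_gt0 u; have [U0 _] := U1.
rewrite (Rintegral_tucker_fun b_gt0 U0); last by move=> i j c; have [] := u1 i j.
exact: tucker_mass1.
Qed.

Lemma measurable_cover_yatracos (ab : I * I) : measurable (yatracos_set q ab).
Proof.
rewrite -[X in measurable X]setTI.
have mq u : measurable_fun setT (q u) by exact: measurable_tucker_fun.
exact: (measurable_fun_ltr (mq ab.2) (mq ab.1) measurableT (Y := [set true])).
Qed.

(** The set [S] is arbitrary because the estimator takes finitely many values, each on a measurable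
    set of samples. *)
Lemma measurable_cover_estimator (S : set (T -> R)) :
  measurable (cover_estimator @^-1` S).
Proof.
exact: (measurable_selection (lebesgue R d) _ measurable_cover_yatracos (q @^-1` S)).
Qed.

Lemma cover_estimator_estimator : estimator H cover_estimator.
Proof.
split=> [X _|U _]; last first.
  by apply: measurableI; [exact: measurable_samples|exact: measurable_cover_estimator].
apply/tucker_histogramP; rewrite /cover_estimator; set u := selection _ _ _ _.
have [U1 u1] := cover_density_prob (R := R) c0 S0 b_gt0 k_gt0 u.
by eexists _, _; split; [exact: U1|exact: u1|].
Qed.

(** For each [h] in the class, a grid point within [cover_radius] of [h] serves as the competitor in
    [selection_bound]; the three radii and [4 * t] are absorbed in [eps]. *)
Lemma cover_estimator_bound (p : density R d) (eps t : R) (X : n.-tuple T) :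
  3 * @cover_radius R d b k + 4 * t <= eps ->
  (forall ab, `|empirical R X (yatracos_set q ab) -
                fine (law p (yatracos_set q ab))| <= t) ->
  (L1norm (cover_estimator X \- p)%R <= 3%:E * L1dist H p + eps%:E)%E.
Proof.
move=> teps dev.
have int_p := integrable_pdf p; have qi := integrable_cover_density.
rewrite L1norm_Rintegral; last by apply: integrable_subr => //; exact: qi.
set N := \int[_]_x _.
(* Solved for the distance to [h], the inequality is a lower bound that passes to the infimum over
   [h]. *)
have N_le h : H h -> (((N - eps) / 3)%:E <= L1norm (p \- h)%R)%E.
  move=> Hh.
  have [u uh] := cover_density_approx c0 S0 b_gt0 k_gt0 Hh.
  have hi : mu.-integrable setT (EFin \o h).
    move/tucker_histogramP : Hh => [W [w [[W0 _] w1 ->]]].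
    by apply: (integrable_tucker_fun b_gt0 W0) => i j c; have [] := w1 i j.
  rewrite L1norm_Rintegral ?lee_fin; last exact: integrable_subr.
  have NE : N <= 3 * \int[mu]_x `|q u x - p x| + 4 * t.
    apply: selection_bound => //; first exact: measurable_cover_yatracos.
    by move=> i; rewrite Rintegral_pdf Rintegral_cover_density.
  have tri : \int[mu]_x `|q u x - p x| <=
      \int[mu]_x `|q u x - h x| + \int[mu]_x `|h x - p x|.
    have := Rintegral_normrD (integrable_subr (qi u) hi) (integrable_subr hi int_p).
    by under eq_Rintegral do rewrite subrKA.
  have sym1 : \int[mu]_x `|q u x - h x| = \int[mu]_x `|h x - q u x|.
    by apply: eq_Rintegral => x _; rewrite distrC.
  have sym2 : \int[mu]_x `|h x - p x| = \int[mu]_x `|p x - h x|.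
    by apply: eq_Rintegral => x _; rewrite distrC.
  by rewrite /= in sym2 *; lra.
have : (((N - eps) / 3)%:E <= L1dist H p)%E.
  by apply: le_ereal_inf_tmp => _ [h Hh <-]; exact: N_le.
rewrite -(@lee_pmul2l _ 3%:E)// => NL.
have -> : N%:E = (3%:E * ((N - eps) / 3)%:E + eps%:E)%E.
  by rewrite -EFinM -EFinD; congr EFin; field.
by rewrite leeD2r.
Qed.

Lemma cover_estimator_deviation (p : density R d) (eps t : R) : (0 < n)%N ->
  0 <= t <= 2 -> 3 * @cover_radius R d b k + 4 * t <= eps ->
  (sample_law p n [set X | samples X /\
     3%:E * L1dist H p + eps%:E < L1norm (cover_estimator X \- p)%R] <=
   (#|{: I * I}|%:R * (2 * expR (- (n%:R * t ^+ 2 / 8))))%:E)%E.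
Proof.
move=> n0 t02 teps; apply: uniform_deviation => //.
- exact: measurable_cover_yatracos.
- rewrite (_ : [set X | _] = @samples R d n `&` cover_estimator @^-1`
    [set f | 3%:E * L1dist H p + eps%:E < L1norm (f \- p)%R]%E)//.
  by apply: measurableI; [exact: measurable_samples|exact: measurable_cover_estimator].
(* Contraposition: if no Yatracos set deviates by more than [t], the error bound holds. *)
- move=> X [_]; rewrite ltNge => /negP NX; apply: contrapT => noX; apply: NX.
  apply: cover_estimator_bound teps _ => ab; rewrite leNgt; apply/negP => abX.
  by apply: noX; exists ab.
Qed.

End deviation.

(** * Asymptotics *)

Section asymptotics.
Context {R : realType}.

Lemma cvg_natr_inv (u : nat -> nat) : u n @[n --> \oo] --> \oo ->
  ((u n)%:R^-1 : R) @[n --> \oo] --> (0 : R).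
Proof.
move=> uoo; rewrite (gtr0_cvgV0 _); first exact/cvgrnyP.
by near=> n; rewrite ltr0n; near: n; exact: (cvgnyPge _).1 uoo 1%N.
Unshelve. all: by end_near. Qed.

Lemma cvg_cover_radius (d : nat) (b k : nat -> nat) : (1 <= d)%N ->
  b n @[n --> \oo] --> \oo -> k n @[n --> \oo] --> \oo ->
  @cover_radius R d (b n) (k n) @[n --> \oo] --> (0 : R).
Proof.
move=> d1 b_oo k_oo.
have K_oo : (k n ^ d)%N @[n --> \oo] --> \oo.
  apply/cvgnyPge => A; near=> n; apply: (@leq_trans (k n)).
    by near: n; exact: (cvgnyPge _).1 k_oo A.
  by case: (k n) => // m; rewrite -[leqLHS]expn1 leq_pexp2l.
have -> : 0 = 2 * (1 - (1 - 0) * (1 - 0) ^+ d) :> R.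
  by rewrite subr0 expr1n mulr1 subrr mulr0.
apply: cvgMr; apply: cvgB; first exact: cvg_cst.
apply: cvgM; first by apply: cvgB; [exact: cvg_cst|exact: cvg_natr_inv].
apply: (@cvg_comp _ _ _ (fun n => 1 - (b n)%:R^-1) (fun x : R => x ^+ d) _
  (nbhs (1 - 0 : R))); last exact: exprn_continuous.
by apply: cvgB; [exact: cvg_cst|exact: cvg_natr_inv].
Unshelve. all: by end_near. Qed.

Lemma natr_expE (m e : nat) : (0 < m)%N ->
  (m ^ e)%:R = expR (e%:R * ln m%:R) :> R.
Proof. by move=> m0; rewrite natrX expRM_natl lnK// posrE ltr0n. Qed.

(** With [D] the denominator of the rate, [N <= expR (3 * d * D)], hence [N^2 <= expR (6 * d * D)].
    The constant 96 makes [6 * d * D] at most [n * t^2 / 16], half of the Chernoff exponent. *)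
Lemma cover_size_le (d b k N n : nat) (t : R) : (1 <= d)%N ->
  (2 <= b)%N -> (2 <= k ^ d)%N -> 
  (N <= (k ^ d) ^ (3 * k ^ d) * b ^ (3 * (b * (d * k))))%N ->
  96 * d%:R * (b%:R * k%:R * ln b%:R + (k ^ d)%:R * ln (k ^ d)%:R) <= n%:R * t ^+ 2 ->
  (N * N)%:R * (2 * expR (- (n%:R * t ^+ 2 / 8))) <= 2 * expR (- (t ^+ 2 / 16)) ^+ n.
Proof.
move=> d1 b2 K2 NK; set D := _ + _ => nD.
have lnK0 : 0 <= (k ^ d)%:R * ln (k ^ d)%:R :> R.
  by rewrite mulr_ge0// ln_ge0// ler1n; lia.
have dR : 1 <= d%:R :> R by rewrite ler1n.
have NR : N%:R <= expR (3 * d%:R * D).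
  apply: (@le_trans _ _ ((k ^ d) ^ (3 * k ^ d) * b ^ (3 * (b * (d * k))))%:R).
    by rewrite ler_nat.
  have K0 : (0 < k ^ d)%N by exact: leq_trans K2.
  have b0 : (0 < b)%N by exact: leq_trans b2.
  rewrite natrM (natr_expE (3 * k ^ d) K0) (natr_expE (3 * (b * (d * k))) b0).
  rewrite -expRD ler_expR /D !natrM.
  set x := ln b%:R; set y := (k ^ d)%:R * _ in lnK0 *.
  have -> : 3 * (k ^ d)%:R * ln (k ^ d)%:R = 3 * y by rewrite /y mulrA.
  nra.
rewrite natrM -expRM_natl mulrCA ler_pM2l//.
apply: (@le_trans _ _ (expR (3 * d%:R * D) * expR (3 * d%:R * D) *
    expR (- (n%:R * t ^+ 2 / 8)))).
  by rewrite ler_pM2r ?expR_gt0// ler_pM.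
by rewrite -!expRD ler_expR; lra.
Qed.

End asymptotics.

Theorem theorem2p2 (R : realType) (d : nat) (d_ge1 : (1 <= d)%N)
  (b k : nat -> nat)
  (b_gt0 : forall n, (0 < b n)%N) (k_gt0 : forall n, (0 < k n)%N)
  (b_oo : b n @[n --> \oo] --> \oo) (k_oo : k n @[n --> \oo] --> \oo)
  (rate : (n%:R / ((b n)%:R * (k n)%:R * ln (b n)%:R +
                   (k n ^ d)%:R * ln (k n ^ d)%:R) : R)
          @[n --> \oo] --> +oo) :
  exists V : forall n, n.-tuple (d.-tuple (measurableTypeR R)) ->
                       d.-tuple (measurableTypeR R) -> R,
    (forall n, estimator (@tucker_histogram R d (b n) (k n)) (V n)) /\
    forall eps : R, 0 < eps ->
      ereal_sup [set sample_law p n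
          [set X | samples X /\
            (3%:E * L1dist (@tucker_histogram R d (b n) (k n)) p + eps%:E
             < L1norm (V n X \- p)%R)%E] | p in [set: density R d]]
      @[n --> \oo] --> (0 : \bar R)%E.
Proof.
(* The first bin and the constant core index receive the rounding defects. *)
pose c0 n : 'I_(b n) := Ordinal (b_gt0 n).
pose S0 n : d.-tuple 'I_(k n) := [tuple of nseq d (Ordinal (k_gt0 n))].
exists (fun n => cover_estimator (c0 n) (S0 n) (n := n)); split.
  by move=> n; exact: cover_estimator_estimator.
move=> eps eps0.
(* Then [4 * t <= eps / 2], and [t <= 2] as the tail bound requires. The other half of [eps] pays
   for three radii of at most [eps / 6]. *)
pose t : R := Num.min (eps / 8) 2.
have t0 : 0 < t by rewrite lt_min divr_gt0/=.
have [te t2] : t <= eps / 8 /\ t <= 2 by rewrite !ge_min !lexx orbT.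
have dR : 0 < d%:R :> R by rewrite ltr0n.
pose q := expR (- (t ^+ 2 / 16)).
have q1 : `|q| < 1.
  by rewrite ger0_norm ?expR_ge0// -expR0 ltr_expR oppr_lt0 divr_gt0// exprn_gt0.
have bound_cvg : (2 * q ^+ n)%:E @[n --> \oo] --> (0 : \bar R)%E.
  apply/cvg_EFin; first exact: nearW.
  rewrite -[X in _ --> X](mulr0 2); apply: cvgMr; exact: cvg_expr.
have e6 : 0 < eps / 6 by rewrite divr_gt0.
apply: squeeze_cvge (cvg_cst 0%E) bound_cvg.
near=> n.
have n0 : (0 < n)%N by near: n; exact: nbhs_infty_gt.
have b2 : (2 <= b n)%N by near: n; exact: (cvgnyPge _).1 b_oo 2%N.
have k2 : (2 <= k n)%N by near: n; exact: (cvgnyPge _).1 k_oo 2%N.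
have K2 : (2 <= k n ^ d)%N.
  by rewrite (leq_trans k2)// -[leqLHS]expn1 leq_pexp2l// k_gt0.
have rad : @cover_radius R d (b n) (k n) <= eps / 6.
  by near: n; exact: cvgr_le (cvg_cover_radius d_ge1 b_oo k_oo) _ e6.
have rate_n : 96 * d%:R / t ^+ 2 <= n%:R / ((b n)%:R * (k n)%:R * ln (b n)%:R +
                   (k n ^ d)%:R * ln (k n ^ d)%:R).
  by near: n; exact: (cvgryPge _).1 rate _.
(* The lower bound 0 on the supremum comes from one member, the uniform density. *)
apply/andP; split.
  apply: le_trans (ereal_sup_ubound _); last by exists uniform_density.
  exact: measure_ge0.
apply: ge_ereal_sup => _ [p _ <-].
apply: le_trans (cover_estimator_deviation (b_gt0 n) (k_gt0 n) (c0 n) (S0 n) p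
  n0 (t := t) _ _) _.
- by rewrite (ltW t0) t2.
- lra.
rewrite lee_fin card_prod; apply: (cover_size_le d_ge1 b2 K2 (card_cover b2 K2)).
set D := _ + _ in rate_n *.
(* Positivity comes from the core term, as [k n ^ d >= 2]; it allows the division in [rate_n] to be
   cleared. *)
have D0 : 0 < D.
  rewrite /D ltr_wpDl//.
    by rewrite mulr_ge0// ln_ge0// ler1n b_gt0.
  by rewrite mulr_gt0// ?ltr0n ?(leq_trans _ K2)// ln_gt0// ltr1n.
by move: rate_n; rewrite ler_pdivrMr ?exprn_gt0// mulrAC ler_pdivlMr.
Unshelve. all: by end_near. Qed.
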